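(* Let $K \subseteq \mathbb{R}^n$ be a proper cone and let $A, B, C, D \in \mathbb{R}^{n \times n}$. Suppose that the block matrix $$L = \begin{pmatrix} A & B \\ C & D \end{pmatrix} \in \mathbb{R}^{2n \times 2n}$$ is cross-positive on $K \times K$. Then $L$ is stable if and only if the equation $$XBX + DX + XA + C = 0$$ has a solution $X_* \in \mathbb{R}^{n\times n}$ with $X_* \succeq_K 0$ such that $A + BX_*$ and $D + X_* B$ are both stable and cross-positive on $K$.
   Context: A set $K \subseteq \mathbb{R}^m$ is a cone if $x \in K$ and $\alpha \geq 0$ imply $\alpha x \in K$. A cone is proper if it is convex, closed, pointed ($K \cap -K = \{0\}$) and has non-empty interior. The dual cone of a proper cone $K \subseteq \mathbb{R}^m$ is $K_* = \{y \in \mathbb{R}^m \mid y^T x \geq 0 \text{ for all } x \in K\}$. A matrix $M \in \mathbb{R}^{m \times m}$ is cross-positive on a proper cone $K \subseteq \mathbb{R}^m$ if $x \in K$, $y \in K_*$ and $y^T x = 0$ imply $y^T M x \geq 0$. If $K \subseteq \mathbb{R}^n$ is a proper cone, then $K \times K$ is a proper cone in $\mathbb{R}^{2n}$, with $(K\times K)_* = K_* \times K_*$. For a matrix $X \in \mathbb{R}^{n\times n}$, $X \succeq_K 0$ means that $X$ is $K$-nonnegative, i.e. $XK \subseteq K$. A square real matrix is stable if all its eigenvalues have (strictly) negative real part. *)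

(* Defs.v *)
From HB Require Import structures.
From mathcomp Require Import all_boot all_order all_algebra.
From mathcomp Require Import complex.
From mathcomp Require Import all_classical all_reals all_analysis.

Set Implicit Arguments.
Unset Strict Implicit.
Unset Printing Implicit Defensive.

Import Order.TTheory GRing.Theory Num.Theory.
Import numFieldNormedType.Exports.

Local Open Scope classical_set_scope.
Local Open Scope ring_scope.

Section Cones.
Context {R : realType} {m : nat}.
Implicit Types (K : set 'cV[R]_m) (M : 'M[R]_m).

(* K is not required to be nonempty here; nonemptiness is part of
   [proper_cone] through pointedness. *)
Definition cone K : Prop :=
  forall (x : 'cV[R]_m) (a : R), K x -> 0 <= a -> K (a *: x).

Definition pointed K : Prop := K `&` [set - x | x in K] = [set 0].

Definition proper_cone K : Prop :=
  [/\ cone K, convex_set K, closed K, pointed K & K° !=set0].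

(* [y^T *m x] is a 1 x 1 matrix, whose only entry is the inner product. *)
Definition dual_cone K : set 'cV[R]_m :=
  [set y | forall x, K x -> 0 <= (y^T *m x) 0 0].

Definition cross_positive K M : Prop :=
  forall x y : 'cV[R]_m, K x -> dual_cone K y ->
    (y^T *m x) 0 0 = 0 -> 0 <= (y^T *m M *m x) 0 0.

Definition cone_nonneg K M : Prop := [set M *m x | x in K] `<=` K.

(* The eigenvalues of a real matrix are those of its image over R[i]. *)
Definition stable M : Prop :=
  forall z : R[i], eigenvalue (map_mx (real_complex R) M) z -> complex.Re z < 0.

End Cones.

(* A vector of R^(n + n) is the stacking of its upper and lower halves. *)
Definition cone_prod {R : realType} {n : nat} (K1 K2 : set 'cV[R]_n) :
    set 'cV[R]_(n + n) :=
  [set z | K1 (usubmx z) /\ K2 (dsubmx z)].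

(* Main.v *)
Require Import Defs.
From mathcomp Require Import all_boot all_order all_algebra.
From mathcomp Require Import complex ring lra.
From mathcomp Require Import all_classical all_reals all_analysis.
Import Order.TTheory GRing.Theory Num.Theory.
Import numFieldNormedType.Exports.
Local Open Scope classical_set_scope.
Local Open Scope ring_scope.

Set Implicit Arguments.
Unset Strict Implicit.
Unset Printing Implicit Defensive.

(** For a matrix [M] cross-positive on a proper cone, stability is equivalent to
    a decrease condition: [M] maps some interior point [v] to the opposite of an
    interior point.  Both directions ([stable_of_decrease] and
    [strict_decrease_of_stable]), as well as the positivity of [- M^-1] under
    this condition ([inverse_positive]), come from one device.  Given a vector
    compared with [v] in the cone order, take the functional of the dual cone at
    which the comparison is tight; it exists by compactness, and cross-positivity
    says in which direction [M] pushes the two vectors apart there.  Proper cones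
    enter only through their dual ([regular_cone]), so the same statements apply
    to [K] and to [K x K].

    Write [x <= y] for [K (y - x)] and [x < y] when [y - x] is interior.

    From a solution to stability ([block_stable_of_riccati]): the Riccati
    equation says that the lower component of [L (x, X x + d)] is
    [(D + X B) d - X w], where [w = (A + B X) x + B d] is the upper one.  The
    inverses of [- (D + X B)] and [- (A + B X)] are nonnegative, so [d] and [x]
    can be chosen in [K] such that both components equal [- e] with [e]
    interior.  This is a decrease condition for [L].

    From stability to a solution ([riccati_of_block_stable]): the decrease
    condition for [L] gives interior [x0], [y0] with [A x0 + B y0 < 0] and
    [C x0 + D y0 < 0].  As [B] and [C] are nonnegative, [A] decreases [x0] and
    [D] decreases [y0], which makes the Sylvester operator
    [X |-> D X + X A] bijective with nonpositive inverse
    ([sylvester_inverse_nonneg]).  The monotone iteration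
    [D X' + X' A = - (X B X + C)] preserves the compact set of nonnegative [X]
    such that [X x0 <= y0] and [X B X + D X + X A + C] is nonnegative, and it
    increases [X]; an element of this set maximal for a strictly positive
    functional is therefore a solution ([riccati_solution]).  Finally
    [(A + B X) x0 <= A x0 + B y0 < 0], and [D + X B] maps the nonnegative vector
    [y0 - X x0] to [C x0 + D y0 + X (A x0 + B y0) < 0]; these are decrease
    conditions for the two remaining matrices. *)

(** * Continuity and compactness for real matrices *)

Section Continuity.
Context {R : realType}.

Lemma mx_continuous (T : topologicalType) m n (f : T -> 'M[R]_(m, n)) :
  (forall i j, continuous (fun t => f t i j)) -> continuous f.
Proof.
move=> fc t A [P PN sP].
have: \forall s \near t, forall ij : 'I_m * 'I_n, P ij.1 ij.2 (f s ij.1 ij.2).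
  by apply: filter_forall => ij; exact: fc (PN ij.1 ij.2).
by apply: filterS => s Ps; apply: sP => i j; exact: (Ps (i, j)).
Qed.

Lemma addf_continuous (T : topologicalType) (f g : T -> R) :
  continuous f -> continuous g -> continuous (fun t => f t + g t).
Proof. by move=> fc gc t; apply: cvgD; [exact: fc | exact: gc]. Qed.

Lemma oppf_continuous (T : topologicalType) (f : T -> R) :
  continuous f -> continuous (fun t => - f t).
Proof. by move=> fc t; apply: cvgN; exact: fc. Qed.

Lemma mulf_continuous (T : topologicalType) (f g : T -> R) :
  continuous f -> continuous g -> continuous (fun t => f t * g t).
Proof. by move=> fc gc t; apply: cvgM; [exact: fc | exact: gc]. Qed.

Lemma sum_continuous (T : topologicalType) n (h : 'I_n -> T -> R) :
  (forall k, continuous (h k)) -> continuous (fun t => \sum_(k < n) h k t).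
Proof.
elim: n h => [|n IHn] h hc t.
  by under eq_fun do rewrite big_ord0; exact: cvg_cst.
under eq_fun do rewrite big_ord_recr /=.
by apply: cvgD; [exact: IHn | exact: hc].
Qed.

Lemma mulmx_continuous (T : topologicalType) m n p
    (f : T -> 'M[R]_(m, n)) (g : T -> 'M[R]_(n, p)) :
  continuous f -> continuous g -> continuous (fun t => f t *m g t).
Proof.
move=> fc gc; apply: mx_continuous => i j.
under eq_fun do rewrite mxE.
apply: sum_continuous => k t; apply: cvgM.
  exact: (continuous_comp (fc t) (@coord_continuous R _ _ i k _)).
exact: (continuous_comp (gc t) (@coord_continuous R _ _ k j _)).
Qed.

Lemma addmx_continuous (T : topologicalType) m n (f g : T -> 'M[R]_(m, n)) :
  continuous f -> continuous g -> continuous (fun t => f t + g t).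
Proof.
move=> fc gc; apply: mx_continuous => i j; under eq_fun do rewrite mxE.
apply: addf_continuous => t.
  exact: (continuous_comp (fc t) (@coord_continuous R _ _ i j _)).
exact: (continuous_comp (gc t) (@coord_continuous R _ _ i j _)).
Qed.

Lemma trmx_continuous (T : topologicalType) m n (f : T -> 'M[R]_(m, n)) :
  continuous f -> continuous (fun t => (f t)^T).
Proof.
move=> fc; apply: mx_continuous => i j.
rewrite (_ : (fun t => _) = (fun t => f t j i)); last first.
  by apply/funext => t; rewrite mxE.
by move=> t; exact: (continuous_comp (fc t) (@coord_continuous R _ _ j i _)).
Qed.

(** Heine-Borel for rectangular matrices: reading a row vector of length
    [m * n] as a matrix is continuous, so the result for row vectors
    transfers. *)
Lemma bounded_closed_compact_mx m n (A : set 'M[R]_(m, n)) c :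
  (forall X, A X -> forall i j, `|X i j| <= c) -> closed A -> compact A.
Proof.
move=> Ac cA.
have vec_cts : continuous (@vec_mx R m n).
  apply: mx_continuous => i j.
  rewrite (_ : (fun t => _) = (fun t : 'rV[R]_(m * n) => t 0 (mxvec_index i j))).
    exact: coord_continuous.
  by apply/funext => t; rewrite mxE.
have -> : A = [set vec_mx v | v in (@vec_mx R m n @^-1` A)].
  apply/seteqP; split => [X AX|_ [v Av <-]//].
  by exists (mxvec X); rewrite /= mxvecK.
apply: continuous_compact; first exact: continuous_subspaceT.
apply: bounded_closed_compact; last first.
  by apply: preimage_closed => // x _; exact: vec_cts.
exists (Num.max c 0); split; first by rewrite num_real.
move=> M cM v Av; change (mx_norm v <= M); rewrite mx_normrE.
move: cM; rewrite gt_max => /andP[cM M0].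
apply/bigmax_leP; split => /=; first exact: ltW.
move=> [i j] _ /=; rewrite ord1; case/mxvec_indexP: j => k l.
by apply: le_trans (ltW cM); rewrite -(vec_mxK v) mxvecE; exact: Ac.
Qed.

(** The quotient [f / g] attains its minimum; clearing denominators spares
    the users any division. *)
Lemma compact_ratio_min (T : topologicalType) (A : set T) (f g : T -> R) :
  A !=set0 -> compact A -> continuous f -> continuous g ->
  (forall t, A t -> 0 < g t) ->
  exists2 c, A c & forall t, A t -> f c * g t <= f t * g c.
Proof.
move=> A0 cA fc gc g0.
have [|c cA' cmin] := compact_EVT_min A0 cA (f := fun t => f t / g t).
  rewrite continuous_subspace_in => t /set_mem At.
  apply: (@continuous_subspaceT_for _ _ A (fun t => f t / g t)) => //.
  apply: cvgM; first exact: fc.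
  by apply: cvgV; [rewrite gt_eqF// g0 | exact: gc].
exists c => [|t At]; first exact: set_mem.
have gc0 := g0 _ (set_mem cA'); have gt0 := g0 _ At.
have := cmin t (mem_set At).
by rewrite ler_pdivlMr// mulrAC ler_pdivrMr.
Qed.

End Continuity.

(** * The Euclidean pairing *)

Section DotProduct.
Context {R : realType} {n : nat}.
Implicit Types (p q x y : 'cV[R]_n) (a : R) (M : 'M[R]_n).

Definition dot p x : R := (p^T *m x) 0 0.

Lemma dotE p x : dot p x = \sum_i p i 0 * x i 0.
Proof. by rewrite /dot mxE; apply: eq_bigr => i _; rewrite mxE. Qed.

Lemma dotC p x : dot p x = dot x p.
Proof. by rewrite !dotE; apply: eq_bigr => i _; rewrite mulrC. Qed.

Lemma dotDr p x y : dot p (x + y) = dot p x + dot p y.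
Proof. by rewrite /dot mulmxDr mxE. Qed.

Lemma dotZr p a x : dot p (a *: x) = a * dot p x.
Proof. by rewrite /dot -scalemxAr mxE. Qed.

Lemma dotNr p x : dot p (- x) = - dot p x.
Proof. by rewrite /dot mulmxN mxE. Qed.

Lemma dotBr p x y : dot p (x - y) = dot p x - dot p y.
Proof. by rewrite dotDr dotNr. Qed.

Lemma dot0r p : dot p 0 = 0.
Proof. by rewrite /dot mulmx0 mxE. Qed.

Lemma dotDl p q x : dot (p + q) x = dot p x + dot q x.
Proof. by rewrite !(dotC _ x) dotDr. Qed.

Lemma dotZl p a x : dot (a *: p) x = a * dot p x.
Proof. by rewrite !(dotC _ x) dotZr. Qed.

Lemma dot0l x : dot 0 x = 0.
Proof. by rewrite dotC dot0r. Qed.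

Lemma dot_mulmx p M x : dot p (M *m x) = dot (M^T *m p) x.
Proof. by rewrite /dot trmx_mul trmxK mulmxA. Qed.

Lemma outer_mulmx (v phi x : 'cV[R]_n) : v *m phi^T *m x = dot phi x *: v.
Proof.
by rewrite -mulmxA (mx11_scalar (phi^T *m x)) mul_mx_scalar.
Qed.

Lemma dot_self_ge0 x : 0 <= dot x x.
Proof. by rewrite dotE sumr_ge0// => i _; rewrite -expr2 sqr_ge0. Qed.

Lemma dot_self_eq0 x : (dot x x == 0) = (x == 0).
Proof.
apply/eqP/eqP => [|->]; last exact: dot0r.
rewrite dotE => /psumr_eq0P x0; apply/matrixP => i j; rewrite ord1 !mxE.
apply/eqP; rewrite -sqrf_eq0 expr2; apply/eqP/x0 => // k _.
by rewrite -expr2 sqr_ge0.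
Qed.

Lemma dot_continuous (T : topologicalType) (f g : T -> 'cV[R]_n) :
  continuous f -> continuous g -> continuous (fun t => dot (f t) (g t)).
Proof.
move=> fc gc t.
have hc := mulmx_continuous (trmx_continuous fc) gc.
exact: (continuous_comp (hc t) (@coord_continuous R _ _ 0 0 _)).
Qed.

Lemma dot_continuousl x : continuous (fun p => dot p x).
Proof.
apply: (@dot_continuous _ id (cst x)) => [p|]; last exact: cst_continuous.
exact: cvg_id.
Qed.

Lemma cross_positiveE (K : set 'cV[R]_n) M : cross_positive K M <->
  forall p x, dual_cone K p -> K x -> dot p x = 0 -> 0 <= dot p (M *m x).
Proof.
split=> cM p x => [Kp Kx px0|Kp Kx px0].
  by rewrite /dot mulmxA; exact: cM.
by rewrite -mulmxA; exact: cM.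
Qed.

End DotProduct.

(** * Compact bases of dual cones *)

Section DualSphere.
Context {R : realType} {n : nat}.
Implicit Types (Z : set 'cV[R]_n) (p x : 'cV[R]_n).

(** Every nonzero element of the dual cone is a positive multiple of one of
    these, and they form a compact set: minima of homogeneous functions over
    the dual cone are attained here. *)
Definition dual_sphere Z : set 'cV[R]_n :=
  [set p | dual_cone Z p /\ `|p| = 1].

Lemma closed_dual_cone Z : closed (dual_cone Z).
Proof.
have -> : dual_cone Z = \bigcap_(x in Z) ((fun p => dot p x) @^-1` [set a | 0 <= a]).
  by apply/seteqP; split => p Zp x; exact: Zp.
apply: closed_bigI => x _; apply: preimage_closed; last exact: closed_ge.
by move=> p _; exact: dot_continuousl.
Qed.

Lemma coord_le_norm m k (X : 'M[R]_(m, k)) i j : `|X i j| <= `|X|.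
Proof.
change (`|X i j| <= mx_norm X); rewrite mx_normrE.
exact: (@le_bigmax _ _ _ _ (fun ij : 'I_m * 'I_k => `|X ij.1 ij.2|) (i, j)).
Qed.

Lemma compact_dual_sphere Z : compact (dual_sphere Z).
Proof.
apply: (@bounded_closed_compact_mx R n 1 _ 1) => [p [_ <-] i j|].
  exact: coord_le_norm.
apply: closedI; first exact: closed_dual_cone.
apply: (@preimage_closed _ _ (fun p : 'cV[R]_n => `|p|) [set 1]); last first.
  exact: closed_eq.
by move=> p _; exact: norm_continuous.
Qed.

Lemma dual_coneZ Z a p : 0 <= a -> dual_cone Z p -> dual_cone Z (a *: p).
Proof.
move=> a0 Zp x Zx; rewrite -/(dot _ _) dotZl mulr_ge0//; exact: Zp.
Qed.

Lemma dual_sphere_normalize Z p : dual_cone Z p -> p != 0 ->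
  dual_sphere Z (`|p|^-1 *: p).
Proof.
move=> Zp p0; split; first by apply: dual_coneZ => //; rewrite invr_ge0.
by rewrite normrZ normfV normr_id mulVf// normr_eq0.
Qed.

Lemma dual_sphere_neq0 Z p : dual_sphere Z p -> p != 0.
Proof. by move=> [_ p1]; rewrite -normr_eq0 p1 oner_neq0. Qed.

(** A quotient of two functions of the same degree of homogeneity is constant
    along rays, so its minimum over the compact [dual_sphere] is a minimum over
    the whole punctured dual cone. *)
Lemma dual_ratio_min Z d (f g : 'cV[R]_n -> R) :
  continuous f -> continuous g ->
  (forall a p, 0 < a -> f (a *: p) = a ^+ d * f p) ->
  (forall a p, 0 < a -> g (a *: p) = a ^+ d * g p) ->
  (forall p, dual_cone Z p -> p != 0 -> 0 < g p) ->
  (exists2 p, dual_cone Z p & p != 0) ->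
  exists c, [/\ dual_cone Z c, c != 0 &
    forall p, dual_cone Z p -> p != 0 -> f c * g p <= f p * g c].
Proof.
move=> fc gc fh gh g0 [q Zq q0].
have [||t [Zt t1]|c Sc cmin] :=
    @compact_ratio_min R _ (dual_sphere Z) f g _ _ fc gc.
- by exists (`|q|^-1 *: q); exact: dual_sphere_normalize.
- exact: compact_dual_sphere.
- by apply: g0 => //; exact: (dual_sphere_neq0 (conj Zt t1)).
exists c; split; [exact: Sc.1|exact: dual_sphere_neq0 Sc|move=> p Zp p0].
have Np : 0 < `|p|^-1 by rewrite invr_gt0 normr_gt0.
have := cmin _ (dual_sphere_normalize Zp p0).
by rewrite fh// gh// mulrCA -mulrA ler_pM2l// exprn_gt0.
Qed.

End DualSphere.

(** * Proper cones described by their dual *)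

Section RegularCone.
Context {R : realType} {n : nat}.
Implicit Types (K : set 'cV[R]_n) (p q x y v : 'cV[R]_n) (a : R) (M : 'M[R]_n).

(** For a proper cone these are the interior points, described without any
    topology. *)
Definition strict K : set 'cV[R]_n :=
  [set x | forall p, dual_cone K p -> p != 0 -> 0 < dot p x].

(** What the argument uses of a proper cone, phrased through the dual cone
    only.  In this form the properties pass to [cone_prod K K] by pure algebra;
    see [proper_cone_regular] and [cone_prod_regular]. *)
Record regular_cone K : Prop := RegularCone {
  bipolar : forall x, (forall p, dual_cone K p -> 0 <= dot p x) -> K x;
  antisym : forall x, K x -> K (- x) -> x = 0;
  strict_nonempty : strict K !=set0 }.

Context {K : set 'cV[R]_n} (regK : regular_cone K).

Lemma dual_ge0 p x : dual_cone K p -> K x -> 0 <= dot p x.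
Proof. by move=> Kp; exact: Kp. Qed.

Lemma cone0 : K 0.
Proof. by apply: (bipolar regK) => p _; rewrite dot0r. Qed.

Lemma coneD x y : K x -> K y -> K (x + y).
Proof.
move=> Kx Ky; apply: (bipolar regK) => p Kp.
by rewrite dotDr addr_ge0// dual_ge0.
Qed.

Lemma coneZ a x : 0 <= a -> K x -> K (a *: x).
Proof.
move=> a0 Kx; apply: (bipolar regK) => p Kp.
by rewrite dotZr mulr_ge0// dual_ge0.
Qed.

Lemma strictW x : strict K x -> K x.
Proof.
move=> sx; apply: (bipolar regK) => p Kp.
by have [->|p0] := eqVneq p 0; [rewrite dot0l|rewrite ltW// sx].
Qed.

Lemma strictD x y : strict K x -> K y -> strict K (x + y).
Proof.
move=> sx Ky p Kp p0; rewrite dotDr ltr_wpDr//; first exact: dual_ge0.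
exact: sx.
Qed.

Lemma strictZ a x : 0 < a -> strict K x -> strict K (a *: x).
Proof. by move=> a0 sx p Kp p0; rewrite dotZr mulr_gt0// sx. Qed.

Lemma dual_separates x : (forall p, dual_cone K p -> dot p x = 0) -> x = 0.
Proof.
move=> x0; apply: (antisym regK); apply: (bipolar regK) => p Kp.
  by rewrite x0.
by rewrite dotNr x0 ?oppr0.
Qed.

Lemma notin_cone x : ~ K x ->
  exists p, [/\ dual_cone K p, p != 0 & dot p x < 0].
Proof.
move=> nKx; apply: contrapT => np; apply: nKx; apply: (bipolar regK) => p Kp.
rewrite leNgt; apply/negP => px; apply: np; exists p; split => //.
by apply: contraTneq px => ->; rewrite dot0l ltxx.
Qed.

(** Move from [x], outside the cone, along the strictly positive direction [v]
    until the boundary is reached: the coefficient [m] is the minimum of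
    [dot p x / dot p v] over the dual cone, and a minimising [p] is a supporting
    functional at the boundary point.  Cross-positivity will be applied at such
    a contact pair. *)
Lemma touching x v : strict K v -> ~ K x ->
  exists m p, [/\ m < 0, dual_cone K p, p != 0, K (x - m *: v) &
    dot p (x - m *: v) = 0].
Proof.
move=> sv /notin_cone[q [Kq q0 qx]].
have [| | | |c [Kc c0 cmin]] :=
    @dual_ratio_min R n K 1 (fun p => dot p x) (fun p => dot p v)
      (@dot_continuousl R n x) (@dot_continuousl R n v).
- by move=> a p _; rewrite dotZl.
- by move=> a p _; rewrite dotZl.
- by move=> p Kp p0; exact: sv.
- by exists q.
have cv : 0 < dot c v by exact: sv.
exists (dot c x / dot c v), c; split => //.
- rewrite pmulr_llt0 ?invr_gt0// -(pmulr_llt0 _ (sv _ Kq q0)).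
  by rewrite (le_lt_trans (cmin _ Kq q0))// pmulr_llt0.
- apply: (bipolar regK) => p Kp; rewrite dotBr dotZr subr_ge0.
  have [->|p0] := eqVneq p 0; first by rewrite !dot0l mulr0.
  by rewrite mulrAC ler_pdivrMr// cmin.
- by rewrite dotBr dotZr divfK ?gt_eqF// subrr.
Qed.

Lemma order_unit v y : strict K v -> exists2 c, 0 < c & K (c *: v + y).
Proof.
move=> sv; have [Ky|nKy] := pselect (K y).
  by exists 1 => //; rewrite scale1r; apply: coneD => //; exact: strictW.
have [m [p [m0 _ _ Kym _]]] := touching sv nKy.
by exists (- m); [rewrite oppr_gt0|rewrite scaleNr addrC].
Qed.

(** If [c *: v + y] is in the cone, then [v + t *: y] is a positive multiple of
    [v] plus a point of the cone as soon as [t < c^-1]. *)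
Lemma strict_open v y : strict K v ->
  exists2 d, 0 < d & forall t, 0 <= t -> t < d -> strict K (v + t *: y).
Proof.
move=> sv; have [c c0 Kc] := order_unit y sv.
exists c^-1 => [|t t0 tc]; first by rewrite invr_gt0.
rewrite (_ : _ + _ = (1 - t * c) *: v + t *: (c *: v + y)); last first.
  by rewrite scalerDr scalerA addrA -scalerDl subrK scale1r.
apply: strictD; last exact: coneZ.
by apply: strictZ => //; rewrite subr_gt0 -ltr_pdivlMr// div1r.
Qed.

(** If [- M] maps one strict point [v] to a strict point, then [- M] is inverse
    positive.  Were [x] outside the cone, [touching] would give a boundary point
    [x - m *: v] with [m < 0] and a functional [p] vanishing there;
    cross-positivity makes [dot p (M *m x) - m * dot p (M *m v)] nonnegative,
    although the first term is at most [0] and the second one makes it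
    negative. *)
Lemma inverse_positive M v x : cross_positive K M ->
  strict K v -> strict K (- (M *m v)) -> K (- (M *m x)) -> K x.
Proof.
move=> /cross_positiveE cM sv sMv KMx; apply: contrapT => nKx.
have [m [p [m0 Kp p0 Kxm pxm]]] := touching sv nKx.
have := cM _ _ Kp Kxm pxm.
rewrite mulmxBr -scalemxAr dotBr dotZr leNgt => /negP; apply.
have := sMv _ Kp p0; have := dual_ge0 Kp KMx.
rewrite !dotNr oppr_ge0 oppr_gt0 => Mx Mv.
by rewrite ltrBlDr (le_lt_trans Mx)// add0r nmulr_rgt0.
Qed.

End RegularCone.

(** * Stability of cross-positive matrices *)

Section Stability.
Context {R : realType} {n : nat}.
Implicit Types (K : set 'cV[R]_n) (p q x y v : 'cV[R]_n) (M : 'M[R]_n).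

(** Eigenvalues are defined through row vectors, whereas cones consist of
    column vectors; this exchanges the two. *)
Lemma eigenvalue_trmx (F : fieldType) m (M : 'M[F]_m) a :
  eigenvalue M^T a = eigenvalue M a.
Proof.
rewrite !eigenvalue_root_char /char_poly.
rewrite -[in RHS]det_tr; congr (root (\det _) a).
by apply/matrixP => i j; rewrite !mxE eq_sym.
Qed.

(** The real plane on which [stable_of_strict_decrease] compares the functionals
    of the dual cone. *)
Lemma complex_eigenvector M (z : R[i]) :
  eigenvalue (map_mx (real_complex R) M) z ->
  exists x y, [/\ (x != 0) || (y != 0),
    M *m x = complex.Re z *: x - complex.Im z *: y &
    M *m y = complex.Re z *: y + complex.Im z *: x].
Proof.
rewrite -eigenvalue_trmx => /eigenvalueP[w wM w0].
exists (\col_i complex.Re (w 0 i)), (\col_i complex.Im (w 0 i)).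
have wi i : \sum_j (M i j)%:C%C * w 0 j = z * w 0 i.
  move/matrixP: wM => /(_ 0 i); rewrite !mxE => <-.
  by apply: eq_bigr => j _; rewrite !mxE mulrC.
split.
- rewrite -negb_and; apply: contra w0 => /andP[/eqP x0 /eqP y0].
  apply/eqP/matrixP => i j; rewrite ord1 mxE; apply/eqP; rewrite eq_complex.
  move/matrixP: x0 => /(_ j 0); rewrite !mxE => ->.
  by move/matrixP: y0 => /(_ j 0); rewrite !mxE => ->; rewrite !eqxx.
- apply/matrixP => i j; rewrite ord1 !mxE.
  have := congr1 (@complex.Re R) (wi i); rewrite raddf_sum /=.
  have -> : complex.Re (z * w 0 i) = complex.Re z * complex.Re (w 0 i) -
      complex.Im z * complex.Im (w 0 i) by case: z {wM wi} (w 0 i) => a b [c d].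
  move=> <-; apply: eq_bigr => k _; rewrite !mxE.
  by case: (w 0 k) => c d /=; rewrite mul0r subr0.
- apply/matrixP => i j; rewrite ord1 !mxE.
  have := congr1 (@complex.Im R) (wi i); rewrite raddf_sum /=.
  have -> : complex.Im (z * w 0 i) = complex.Re z * complex.Im (w 0 i) +
      complex.Im z * complex.Re (w 0 i) by case: z {wM wi} (w 0 i) => a b [c d].
  move=> <-; apply: eq_bigr => k _; rewrite !mxE.
  by case: (w 0 k) => c d /=; rewrite mul0r addr0.
Qed.

(** Let [x + i y] be an eigenvector for [a + i b].  Choose [p] in the dual cone
    maximising [((dot p x)^2 + (dot p y)^2) / (dot p v)^2].  By Cauchy-Schwarz
    the vector [u = dot p x *: x + dot p y *: y] lies below a multiple of [v] in
    the cone order, with contact at [p].  Cross-positivity at that contact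
    compares [dot p (M *m u)], in which the terms in [b] cancel, with
    [dot p (M *m v)], and gives [dot p v * a <= dot p (M *m v) < 0]. *)
Lemma stable_of_strict_decrease K M v : regular_cone K ->
  cross_positive K M -> strict K v -> strict K (- (M *m v)) -> stable M.
Proof.
move=> regK /cross_positiveE cM sv sMv z /complex_eigenvector[x [y [xy0 Mx My]]].
set a := complex.Re z in Mx My *; set b := complex.Im z in Mx My.
(* Functionals separate points, so the maximum below is positive. *)
have [q [Kq q0 qxy]] : exists q, [/\ dual_cone K q, q != 0 &
    (dot q x != 0) || (dot q y != 0)].
  apply: contrapT => nq.
  have null w : (forall q, dual_cone K q -> q != 0 -> dot q w = 0) -> w = 0.
    move=> w0; have {}w0 q : dual_cone K q -> dot q w = 0.
      by have [->|q0 Kq] := eqVneq q 0; [rewrite dot0l|exact: w0].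
    exact: (dual_separates regK).
  have [x0 y0] : x = 0 /\ y = 0.
    by split; apply: null => q Kq q0; apply/eqP; apply: contra_notT nq => h;
      exists q; rewrite h ?orbT.
  by move: xy0; rewrite x0 y0 eqxx.
pose f p := - (dot p x ^+ 2 + dot p y ^+ 2).
pose g p := dot p v ^+ 2.
have sqc w : continuous (fun p : 'cV[R]_n => dot p w ^+ 2).
  under eq_fun do rewrite expr2.
  by apply: mulf_continuous; exact: dot_continuousl.
have [| | | | | |p [Kp p0 pmin]] := @dual_ratio_min R n K 2 f g.
- by apply: oppf_continuous; apply: addf_continuous; exact: sqc.
- exact: sqc.
- by move=> t p _; rewrite /f !dotZl !exprMn -mulrDr mulrN.
- by move=> t p _; rewrite /g !dotZl !exprMn.
- by move=> p Kp p0; rewrite exprn_gt0//; exact: sv.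
- by exists q.
pose u := dot p x *: x + dot p y *: y.
pose r := dot p x ^+ 2 + dot p y ^+ 2.
have pv : 0 < dot p v by exact: sv.
have r0 : 0 < r.
  have := pmin _ Kq q0; rewrite /f /g -/r !mulNr lerN2 => rq.
  have q2 : 0 < dot q x ^+ 2 + dot q y ^+ 2.
    by case/orP: qxy => h; [apply: ltr_pwDl|apply: ltr_pwDr];
      rewrite ?sqr_ge0// exprn_even_gt0.
  rewrite -(pmulr_lgt0 _ (exprn_gt0 2 (sv _ Kq q0))).
  by rewrite (lt_le_trans _ rq)// mulr_gt0// exprn_gt0.
(* The contact point: it vanishes at [p], and the Cauchy-Schwarz inequality
   puts it in the cone. *)
pose w := r *: v - dot p v *: u.
have Kw : K w.
  apply: (bipolar regK) => s Ks; rewrite dotBr !dotZr subr_ge0.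
  have [->|s0] := eqVneq s 0; first by rewrite !dot0l !mulr0.
  have sv0 : 0 < dot s v by exact: sv.
  have := pmin _ Ks s0; rewrite /f /g -/r !mulNr lerN2 => rs.
  have rsv : 0 <= r * dot s v by rewrite mulr_ge0// ltW.
  rewrite (le_trans (ler_norm _))// -ler_sqr ?nnegrE//.
  rewrite real_normK ?num_real// !exprMn dotDr !dotZr.
  apply: (@le_trans _ _ (r * ((dot s x ^+ 2 + dot s y ^+ 2) * dot p v ^+ 2))).
    rewrite [leRHS]mulrA [leLHS]mulrC ler_pM2r ?exprn_gt0// -subr_ge0.
    have -> : r * (dot s x ^+ 2 + dot s y ^+ 2) -
        (dot p x * dot s x + dot p y * dot s y) ^+ 2 =
        (dot p x * dot s y - dot p y * dot s x) ^+ 2 by rewrite /r; ring.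
    exact: sqr_ge0.
  by rewrite expr2 -mulrA ler_pM2l.
have pw : dot p w = 0.
  by rewrite dotBr !dotZr dotDr !dotZr -!expr2 -/r mulrC subrr.
have := cM _ _ Kp Kw pw.
rewrite mulmxBr -!scalemxAr mulmxDr -!scalemxAr Mx My.
rewrite !(dotBr, dotDr, dotZr).
have -> : r * dot p (M *m v) - dot p v * (dot p x * (a * dot p x - b * dot p y) +
    dot p y * (a * dot p y + b * dot p x)) =
    r * (dot p (M *m v) - dot p v * a) by rewrite /r; ring.
rewrite pmulr_rge0// subr_ge0 => pva.
have := sMv _ Kp p0; rewrite dotNr oppr_gt0 => Mv.
by rewrite -(pmulr_rlt0 _ pv) (le_lt_trans pva).
Qed.

(** A small strict perturbation of [v] reduces this to the case where [v] is
    itself strict. *)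
Lemma stable_of_decrease K M v : regular_cone K ->
  cross_positive K M -> K v -> strict K (- (M *m v)) -> stable M.
Proof.
move=> regK cM Kv sMv.
have [e se] := strict_nonempty regK.
have [d d0 sd] := strict_open regK (- (M *m e)) sMv.
have d2 : 0 < d / 2 by rewrite divr_gt0.
apply: (@stable_of_strict_decrease K M (v + (d / 2) *: e)) => //.
  by rewrite addrC; apply: strictD => //; exact: strictZ.
rewrite mulmxDr opprD -scalemxAr -scalerN; apply: sd; first exact: ltW.
by rewrite ltr_pdivrMr// mulr_natr mulr2n ltrDl.
Qed.

Lemma unitmx_row_kernel (F : fieldType) m (M : 'M[F]_m) :
  (forall u : 'rV_m, u *m M = 0 -> u = 0) -> M \in unitmx.
Proof.
move=> M0; rewrite -row_free_unit -kermx_eq0; apply/rowV0P => u.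
by move/sub_kermxP; exact: M0.
Qed.

Lemma stable_unitmx M s : stable M -> 0 <= s -> M - s%:M \in unitmx.
Proof.
move=> sM s0; rewrite -row_free_unit -kermx_eq0.
apply: contraT => ev; have := sM (s%:C)%C; rewrite /= ltNge s0 /=.
suff -> : eigenvalue (map_mx (real_complex R) M) (s%:C)%C by move=> /(_ isT).
rewrite (eigenvalue_map (real_complex R)).
exact: ev.
Qed.

Lemma cross_positive_shift K M s :
  cross_positive K M -> cross_positive K (M - s%:M).
Proof.
move=> /cross_positiveE cM; apply/cross_positiveE => p x Kp Kx px.
by rewrite mulmxBl dotBr mul_scalar_mx dotZr px mulr0 subr0; exact: cM.
Qed.

(** Let [s0] be the infimum of the [s] for which [s - M] maps some strict point
    to a strict point.  If [s0] were nonnegative, stability would make [s0 - M]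
    invertible, so that [s0 *: w - M *m w = e] for a strict [e] and some [w].
    For [s] slightly above [s0] the vector [s *: w - M *m w] is still strict, so
    [inverse_positive] puts [w] in the cone; then a strict point close to [w]
    serves for [s0] and even for values below it, which is absurd. *)
Lemma strict_decrease_of_stable K M : regular_cone K ->
  cross_positive K M -> stable M ->
  exists2 v, strict K v & strict K (- (M *m v)).
Proof.
move=> regK cM stM; have [e se] := strict_nonempty regK.
pose S := [set s | exists2 v, strict K v & strict K (s *: v - M *m v)].
apply: contrapT => nv.
have S_pos : lbound S 0.
  move=> s [v sv ssv]; rewrite leNgt; apply/negP => s0; apply: nv; exists v => //.
  have -> : - (M *m v) = (- s) *: v + (s *: v - M *m v).
    by rewrite scaleNr addrA addNr add0r.
  apply: strictD; last exact: strictW.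
  by apply: strictZ => //; rewrite oppr_gt0.
have S0 : S !=set0.
  have [c c0 Kc] := order_unit regK (- (M *m e)) se.
  exists (1 + c), e => //; rewrite scalerDl scale1r -addrA.
  exact: strictD.
have infS : has_inf S by split => //; exists 0.
pose s0 := inf S.
have s0_ge0 : 0 <= s0 by apply: lb_le_inf.
have [w Mw] : exists w, s0 *: w - M *m w = e.
  exists (- (invmx (M - s0%:M) *m e)).
  rewrite -opprB -mul_scalar_mx -mulmxBl mulmxN opprK mulmxA mulmxV ?mul1mx//.
  exact: stable_unitmx.
have Kw : K w.
  have [d d0 sd] := strict_open regK w se.
  have [s [v sv ssv] sd0] := inf_adherent d0 infS.
  have s0s : s0 <= s by apply: (ge_inf infS.2); exists v.
  apply: (inverse_positive regK (cross_positive_shift s cM) sv).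
    by rewrite mulmxBl mul_scalar_mx opprB.
  rewrite mulmxBl mul_scalar_mx opprB.
  have -> : s *: w - M *m w = e + (s - s0) *: w.
    by rewrite -Mw scalerBl [in RHS]addrC addrA subrK.
  by apply: strictW => //; apply: sd; rewrite ?subr_ge0// ltrBlDl.
have [d1 d10 sd1] := strict_open regK (s0 *: e - M *m e) se.
pose v := w + (d1 / 2) *: e.
have d12 : 0 < d1 / 2 by rewrite divr_gt0.
have sv : strict K v by rewrite /v addrC; apply: strictD => //; exact: strictZ.
have ssv : strict K (s0 *: v - M *m v).
  have -> : s0 *: v - M *m v = e + (d1 / 2) *: (s0 *: e - M *m e).
    rewrite -[X in _ = X + _]Mw /v mulmxDr !scalerDr -scalemxAr opprD addrACA.
    by rewrite scalerN !scalerA (mulrC s0).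
  apply: sd1; first exact: ltW.
  by rewrite ltr_pdivrMr// mulr_natr mulr2n ltrDl.
have [d2 d20 sd2] := strict_open regK (- v) ssv.
have d22 : 0 < d2 / 2 by rewrite divr_gt0.
have : S (s0 - d2 / 2).
  exists v => //; rewrite scalerBl addrAC -scalerN; apply: sd2; first exact: ltW.
  by rewrite ltr_pdivrMr// mulr_natr mulr2n ltrDl.
move=> /(ge_inf infS.2); rewrite -/s0 leNgt => /negP; apply.
by rewrite ltrBlDr ltrDl.
Qed.

End Stability.

(** * Proper cones and their products are regular *)

Section ProperCone.
Context {R : realType} {n : nat}.
Implicit Types (K : set 'cV[R]_n) (p q x y v k : 'cV[R]_n).

Lemma nearest_point K x : closed K -> K !=set0 ->
  exists2 k, K k & forall y, K y -> dot (k - x) (k - x) <= dot (y - x) (y - x).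
Proof.
move=> cK [k0 Kk0]; pose f y := dot (y - x) (y - x).
have fc : continuous f.
  have xc : continuous (fun y : 'cV[R]_n => y - x).
    apply: mx_continuous => i j; under eq_fun do rewrite !mxE.
    apply: addf_continuous; first exact: coord_continuous.
    exact: cst_continuous.
  exact: dot_continuous.
(* Points of [K] outside this compact set are farther from [x] than [k0]. *)
pose S := K `&` f @^-1` [set a | a <= f k0].
have cS : compact S.
  apply: (@bounded_closed_compact_mx R n 1 _ (`|x| + (f k0 + 1))) => [y [_ fy] i j|].
    rewrite ord1 -[y i 0](subrK (x i 0)) addrC (le_trans (ler_normD _ _))//.
    rewrite lerD ?coord_le_norm// -ler_sqr ?nnegrE//; last first.
      by rewrite addr_ge0// dot_self_ge0.
    rewrite real_normK ?num_real//.
    apply: (@le_trans _ _ (f k0)).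
      apply: le_trans fy; rewrite /f dotE (bigD1 i)//= !mxE -expr2 lerDl sumr_ge0//.
      by move=> l _; rewrite -expr2 sqr_ge0.
    have := dot_self_ge0 (k0 - x); rewrite -/(f k0); nra.
  apply: closedI => //; apply: preimage_closed => [y _|]; first exact: fc.
  exact: closed_le.
have S0 : S !=set0 by exists k0; split => /=.
have [k /set_mem[Kk fk] kmin] :=
  compact_EVT_min S0 cS (continuous_subspaceT fc).
exists k => // y Ky; have [fy|/ltW fy] := leP (f y) (f k0).
  by apply: kmin; rewrite inE.
exact: le_trans fk fy.
Qed.

Lemma ge0_of_quadratic (s N : R) : 0 <= N ->
  (forall t, 0 <= t -> t <= 1 -> 0 <= t * s *+ 2 + t ^+ 2 * N) -> 0 <= s.
Proof.
move=> N0 st; rewrite leNgt; apply/negP => s0.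
have D0 : 0 < - s + N + 1 by lra.
(* Small enough for the linear term to win, and never larger than 1. *)
pose t := - s / (- s + N + 1).
have tD : t * (- s + N + 1) = - s by rewrite divfK ?gt_eqF.
have t0 : 0 < t by rewrite divr_gt0// oppr_gt0.
have t1 : t <= 1 by rewrite ler_pdivrMr//; lra.
have := st t (ltW t0) t1.
have -> : t * s *+ 2 + t ^+ 2 * N = t * (s *+ 2 + t * N) by ring.
rewrite pmulr_rge0//.
have : 0 < t * (1 - s) by apply: mulr_gt0 => //; lra.
nra.
Qed.

Lemma dot_sqrD p y (t : R) :
  dot (p + t *: y) (p + t *: y) - dot p p =
  t * dot p y *+ 2 + t ^+ 2 * dot y y.
Proof. by rewrite !(dotDl, dotDr, dotZl, dotZr) (dotC y p); ring. Qed.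

(** The functional is [k - x], where [k] is the point of the cone nearest to
    [x]; moving [k] inside the cone cannot decrease the distance, and the
    first-order condition [ge0_of_quadratic] gives the inequalities. *)
Lemma separation K x : closed K -> K 0 ->
  (forall y k, K y -> K k -> K (y + k)) ->
  (forall a y, 0 <= a -> K y -> K (a *: y)) ->
  ~ K x -> exists2 p, dual_cone K p & dot p x < 0.
Proof.
move=> cK K0 KD KZ nKx.
have [k Kk kmin] := nearest_point x cK (ex_intro _ _ K0).
pose p := k - x.
have perturb t y : K (k + t *: y) -> 0 <= t * dot p y *+ 2 + t ^+ 2 * dot y y.
  by move=> /kmin; rewrite addrAC -subr_ge0 dot_sqrD.
exists p => [y Ky|].
  apply: (@ge0_of_quadratic _ (dot y y)) => [|t t0 _]; first exact: dot_self_ge0.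
  by apply: perturb; apply: KD => //; exact: KZ.
have pk : dot p k <= 0.
  rewrite -oppr_ge0.
  apply: (@ge0_of_quadratic _ (dot k k)) => [|t t0 t1]; first exact: dot_self_ge0.
  rewrite mulrN -mulNr -sqrrN; apply: perturb.
  by rewrite scaleNr -[X in X - _]scale1r -scalerBl; apply: KZ; rewrite ?subr_ge0.
have -> : dot p x = dot p k - dot p p by rewrite -dotBr /p subKr.
have : 0 < dot p p.
  rewrite lt_def dot_self_ge0 dot_self_eq0 andbT subr_eq0.
  by apply: contra_not_neq nKx => <-.
lra.
Qed.

Lemma proper_cone_regular K : proper_cone K -> regular_cone K.
Proof.
move=> [coneK convK clK ptK [e intKe]].
have K0 : K 0.
  suff [] : (K `&` [set - x | x in K]) 0 by [].
  by rewrite ptK.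
have KZ a y : 0 <= a -> K y -> K (a *: y) by move=> a0 Ky; exact: coneK.
have KD y k : K y -> K k -> K (y + k).
  move=> Ky Kk.
  have h1 : (2^-1 : R) <= 1 by lra.
  have h0 : 0 <= (2^-1 : R) by lra.
  have /set_mem := convK y k (Itv01 h0 h1) (mem_set Ky) (mem_set Kk).
  move=> /(KZ 2 _ (ler0n _ _)); congr K.
  rewrite [conv _ _ _]/(_ *: y + _ *: k) /= scalerDr !scalerA.
  by rewrite /unstable.onem; congr (_ + _); rewrite -[RHS]scale1r; congr (_ *: _); field.
split.
- move=> x Kx; apply: contrapT => nKx.
  have [p Kp] := separation clK K0 KD KZ nKx.
  by rewrite ltNge Kx.
- move=> x Kx KNx.
  have : (K `&` [set - x | x in K]) x.
    by split => //; exists (- x) => //; rewrite opprK.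
  by rewrite ptK.
- exists e => p Kp p0.
  have /nbhs_ballP[d /= d0 dK] := intKe.
  have np : 0 < `|p| by rewrite normr_gt0.
  pose t := d / 2 / `|p|.
  have t0 : 0 < t by rewrite !divr_gt0.
  have /Kp : K (e - t *: p).
    apply: dK; rewrite -ball_normE /ball_ /= subKr normrZ gtr0_norm//.
    by rewrite divfK ?gt_eqF//; lra.
  rewrite -/(dot _ _) dotBr dotZr subr_ge0; apply: lt_le_trans.
  by rewrite mulr_gt0// lt_def dot_self_ge0 dot_self_eq0 p0.
Qed.

End ProperCone.

Section ProductCone.
Context {R : realType} {n : nat}.
Implicit Types (K : set 'cV[R]_n) (p q x y v k : 'cV[R]_n).

Lemma dot_col_mx p q x y : dot (col_mx p q) (col_mx x y) = dot p x + dot q y.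
Proof. by rewrite /dot tr_col_mx mul_row_col mxE. Qed.

Lemma cone_prodE K x y : cone_prod K K (col_mx x y) <-> K x /\ K y.
Proof. by rewrite /cone_prod /= col_mxKu col_mxKd. Qed.

Lemma col_mx_neq0 x y : (col_mx x y != 0) = (x != 0) || (y != 0).
Proof. by rewrite col_mx_eq0 negb_and. Qed.

Lemma dual_cone_prod K p q : regular_cone K ->
  dual_cone (cone_prod K K) (col_mx p q) <-> dual_cone K p /\ dual_cone K q.
Proof.
move=> regK; split => [Kpq|[Kp Kq] z]; last first.
  rewrite -[z]vsubmxK => /cone_prodE[Kx Ky]; rewrite -/(dot _ _) dot_col_mx.
  by rewrite addr_ge0//; [exact: Kp|exact: Kq].
have K0 := cone0 regK.
split => x Kx.
  have /Kpq : cone_prod K K (col_mx x 0) by apply/cone_prodE.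
  by rewrite -!/(dot _ _) dot_col_mx dot0r addr0.
have /Kpq : cone_prod K K (col_mx 0 x) by apply/cone_prodE.
by rewrite -!/(dot _ _) dot_col_mx dot0r add0r.
Qed.

Lemma dual_cone0 m (Z : set 'cV[R]_m) : dual_cone Z 0.
Proof. by move=> x _; rewrite -/(dot _ _) dot0l. Qed.

Lemma strict_cone_prod K x y : regular_cone K ->
  strict (cone_prod K K) (col_mx x y) <-> strict K x /\ strict K y.
Proof.
move=> regK; split => [sxy|[sx sy] r].
  split => p Kp p0.
    have := sxy (col_mx p 0); rewrite dot_col_mx dot0l addr0; apply.
      by apply/dual_cone_prod => //; split => //; exact: dual_cone0.
    by rewrite col_mx_neq0 p0.
  have := sxy (col_mx 0 p); rewrite dot_col_mx dot0l add0r; apply.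
    by apply/dual_cone_prod => //; split => //; exact: dual_cone0.
  by rewrite col_mx_neq0 p0 orbT.
rewrite -[r]vsubmxK; set p := usubmx r; set q := dsubmx r.
move=> /(dual_cone_prod _ _ regK)[Kp Kq]; rewrite col_mx_neq0 dot_col_mx.
have [->|p0 _] := eqVneq p 0; first by rewrite dot0l add0r => /sy; exact.
by apply: ltr_pwDl; [exact: sx|exact: dual_ge0 Kq (strictW regK sy)].
Qed.

Lemma cone_prod_regular K : regular_cone K -> regular_cone (cone_prod K K).
Proof.
move=> regK; split => [z zK|z|].
- rewrite -[z]vsubmxK; apply/cone_prodE.
  split; apply: (bipolar regK) => p Kp.
    have := zK (col_mx p 0); rewrite -{1}[z]vsubmxK dot_col_mx dot0l addr0.
    by apply; apply/dual_cone_prod => //; split => //; exact: dual_cone0.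
  have := zK (col_mx 0 p); rewrite -{1}[z]vsubmxK dot_col_mx dot0l add0r.
  by apply; apply/dual_cone_prod => //; split => //; exact: dual_cone0.
- rewrite -[z]vsubmxK opp_col_mx => /cone_prodE[Kx Ky] /cone_prodE[Kx' Ky'].
  by rewrite (antisym regK Kx Kx') (antisym regK Ky Ky') col_mx0.
- have [e se] := strict_nonempty regK.
  by exists (col_mx e e); apply/strict_cone_prod.
Qed.

End ProductCone.

(** * The Sylvester operator on a cone of matrices *)

Section Functionals.
Context {R : realType} {n : nat}.
Context {K : set 'cV[R]_n} (regK : regular_cone K).
Implicit Types (p q x y v k phi : 'cV[R]_n) (A D M X : 'M[R]_n).

Lemma bidual : dual_cone (dual_cone K) = K.
Proof.
apply/seteqP; split => x Kx; last first.
  by move=> p Kp; rewrite -/(dot _ _) dotC; exact: Kp.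
by apply: (bipolar regK) => p Kp; rewrite dotC; exact: Kx.
Qed.

(** A regular cone has enough functionals to separate points, so as long as the
    chosen ones have a common kernel another one can be added to raise the
    rank. *)
Lemma dual_cone_spans r : (r <= n)%N ->
  exists m (F : 'M[R]_(m, n)), (forall i, dual_cone K (row i F)^T) /\
    (r <= \rank F)%N.
Proof.
elim: r => [_|r IHr rn].
  by exists 0%N, 0; split => // -[].
have [m [F [KF rF]]] := IHr (ltnW rn).
have [|Fr] := ltnP r (\rank F); first by exists m, F.
have : kermx F^T != 0.
  by rewrite -mxrank_eq0 mxrank_ker mxrank_tr subn_eq0 -ltnNge (leq_ltn_trans Fr).
case/rowV0Pn => u /sub_kermxP uF u0.
have [p Kp pu] : exists2 p, dual_cone K p & dot p u^T != 0.
  apply: contrapT => np; move: u0 => /eqP; apply.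
  rewrite -[u]trmxK (dual_separates regK (x := u^T)) ?trmx0// => p Kp.
  by apply/eqP; apply: contra_notT np => pu; exists p.
exists (m + 1)%N, (col_mx F p^T); split.
  move=> i; case: (split_ordP i) => j ->; first by rewrite rowKu.
  by rewrite rowKd row_id // trmxK.
apply: (leq_ltn_trans rF); apply: rank_ltmx.
rewrite ltmxE; apply/andP; split; first by rewrite -addsmxE addsmxSl.
apply: contra pu => sF.
have /submxP[w pw] : (p^T <= F)%MS.
  by apply: submx_trans sF; rewrite -addsmxE addsmxSr.
rewrite /dot pw -mulmxA (_ : F *m u^T = 0) ?mulmx0 ?mxE//.
by rewrite -[F]trmxK -trmx_mul uF trmx0.
Qed.

(** The sum of a spanning family of the dual cone: if it vanishes at a point of
    the cone, then so does each member, hence the point is [0]. *)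
Lemma positive_functional :
  exists phi, forall k, K k -> k != 0 -> 0 < dot phi k.
Proof.
have [m [F [KF nF]]] := dual_cone_spans (leqnn n).
exists (\sum_i (row i F)^T) => k Kk k0.
have dotF : dot (\sum_i (row i F)^T) k = \sum_i dot (row i F)^T k.
  rewrite dotC -[k in LHS]trmxK /dot !trmxK mulmx_sumr summxE.
  by apply: eq_bigr => i _; rewrite trmxK -[in LHS]trmx_mul mxE.
have Fk_ge0 i : 0 <= dot (row i F)^T k by exact: KF.
rewrite dotF lt_def sumr_ge0 // andbT; apply: contra k0 => /eqP/psumr_eq0P Fk0.
have Fk : F *m k = 0.
  apply/row_matrixP => i; rewrite row_mul row0.
  have := Fk0 (fun i _ => Fk_ge0 i) i isT; rewrite /dot trmxK => rk0.
  by apply/matrixP => a b; rewrite !ord1 rk0 mxE.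
have full : row_full F by rewrite /row_full eqn_leq rank_leq_col.
by rewrite -[k]mul1mx -(mulVpmx full) -mulmxA Fk mulmx0.
Qed.

(** By [bidual] the cone is itself a dual cone, so [dual_ratio_min] compares a
    positive functional with the norm on it. *)
Lemma cone_norm_bound phi : (forall k, K k -> k != 0 -> 0 < dot phi k) ->
  exists2 c, 0 <= c & forall k, K k -> `|k| <= c * dot phi k.
Proof.
move=> phi_pos.
have [[q Kq q0]|nq] := pselect (exists2 q, K q & q != 0); last first.
  exists 0 => // k Kk; have [->|k0] := eqVneq k 0; first by rewrite normr0 mul0r.
  by case: nq; exists k.
have phi_cts : continuous (fun k : 'cV[R]_n => dot k phi).
  exact: dot_continuousl.
have norm_cts : continuous (fun k : 'cV[R]_n => `|k|).
  by move=> k; exact: norm_continuous.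
have [| | | |k [Kk k0 kmin]] :=
    @dual_ratio_min R n (dual_cone K) 1 _ _ phi_cts norm_cts.
- by move=> a k _; rewrite dotZl.
- by move=> a k a0; rewrite normrZ gtr0_norm.
- by move=> k _ k0; rewrite normr_gt0.
- by exists q; rewrite ?bidual.
rewrite bidual in Kk kmin.
have kphi : 0 < dot k phi by rewrite dotC phi_pos.
exists (`|k| / dot k phi) => [|y Ky]; first by rewrite divr_ge0// ltW.
have [->|y0] := eqVneq y 0; first by rewrite normr0 dot0r mulr0.
by rewrite mulrAC ler_pdivlMr// mulrC [leRHS]mulrC (dotC phi); apply: kmin.
Qed.

Lemma decrease_unitmx M v : cross_positive K M -> strict K v ->
  strict K (- (M *m v)) -> M \in unitmx.
Proof.
move=> cM sv sMv; rewrite -unitmx_tr; apply: unitmx_row_kernel => u uM.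
have Mu : M *m u^T = 0 by rewrite -[M]trmxK -trmx_mul uM trmx0.
suff : u^T = 0 by move=> /(congr1 trmx); rewrite trmxK trmx0.
have K0 := cone0 regK.
by apply: (antisym regK); apply: (inverse_positive regK cM sv sMv);
  rewrite ?mulmxN Mu ?oppr0.
Qed.

(** For a strictly positive functional [phi0] the functional
    [k |-> - dot phi0 (invmx A *m k)] is again strictly positive, because
    [- invmx A] preserves the cone, and composing it with [A] gives
    [- phi0]. *)
Lemma decreasing_functional A v : cross_positive K A -> strict K v ->
  strict K (- (A *m v)) ->
  exists phi, (forall k, K k -> k != 0 -> 0 < dot phi k) /\
    (forall k, K k -> dot phi (A *m k) <= 0).
Proof.
move=> cA sv sAv; have uA := decrease_unitmx cA sv sAv.
have [phi phi_pos] := positive_functional.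
have phi_ge0 k : K k -> 0 <= dot phi k.
  by have [->|k0 Kk] := eqVneq k 0; [rewrite dot0r|rewrite ltW// phi_pos].
exists (- (invmx A)^T *m phi); split => [k Kk k0|k Kk].
  rewrite mulNmx -mulmxN -dot_mulmx dotC dotNr dotC -dotNr -mulmxN.
  apply: phi_pos.
    apply: (inverse_positive regK cA sv sAv).
    by rewrite mulmxA mulmxV// mul1mx opprK.
  apply: contra k0 => /eqP /(congr1 (mulmx A)).
  by rewrite mulmxA mulmxV// mul1mx mulmx0 => /eqP; rewrite oppr_eq0.
rewrite mulNmx -mulmxN -dot_mulmx mulmxA mulVmx// mul1mx.
by rewrite dotC dotNr oppr_le0 dotC phi_ge0.
Qed.

Lemma cone_nonnegP X : cone_nonneg K X <-> forall k, K k -> K (X *m k).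
Proof.
split=> [KX k Kk|KX _ [k Kk <-]]; last exact: KX.
by apply: KX; exists k.
Qed.

(** The argument of [inverse_positive] for the operator
    [X |-> D *m X + X *m A] on the cone of matrices preserving [K], whose
    functionals are generated by [X |-> dot p (X *m k)] with [p] in the dual
    cone and [k] in [K].  The comparison direction is the rank one matrix
    [v *m phi^T], for which the operator is negative because [v] decreases under
    [D] and [phi] under [A]. *)
Lemma sylvester_inverse_nonneg A D v phi X :
  cross_positive K A -> cross_positive K D ->
  strict K v -> strict K (- (D *m v)) ->
  (forall k, K k -> k != 0 -> 0 < dot phi k) ->
  (forall k, K k -> dot phi (A *m k) <= 0) ->
  cone_nonneg K (- (D *m X + X *m A)) -> cone_nonneg K X.
Proof.
move=> /cross_positiveE cA /cross_positiveE cD sv sDv phi_pos phiA.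
move=> /cone_nonnegP KT; apply/cone_nonnegP => k0 Kk0; apply: contrapT => nKXk0.
have [p0 [Kp0 p00 pXk0]] := notin_cone regK nKXk0.
have k00 : k0 != 0.
  by apply: contraTneq pXk0 => ->; rewrite mulmx0 dot0r ltxx.
pose f (t : 'cV[R]_n * 'cV[R]_n) := dot t.1 (X *m t.2).
pose g (t : 'cV[R]_n * 'cV[R]_n) := dot t.1 v * dot phi t.2.
have c1 : continuous (fun t : 'cV[R]_n * 'cV[R]_n => t.1) by move=> t; exact: cvg_fst.
have c2 : continuous (fun t : 'cV[R]_n * 'cV[R]_n => t.2) by move=> t; exact: cvg_snd.
have cst_cts a b (Z : 'M[R]_(a, b)) :
    continuous (fun _ : 'cV[R]_n * 'cV[R]_n => Z).
  exact: cst_continuous.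
have fc : continuous f.
  exact: (dot_continuous c1 (mulmx_continuous (cst_cts _ _ X) c2)).
have gc : continuous g.
  exact: (mulf_continuous (dot_continuous c1 (cst_cts _ _ v))
    (dot_continuous (cst_cts _ _ phi) c2)).
have [|||[p k] [[Kp p1] [Kk k1]] tmin] := @compact_ratio_min R _
    (dual_sphere K `*` dual_sphere (dual_cone K)) f g _ _ fc gc.
- exists (`|p0|^-1 *: p0, `|k0|^-1 *: k0).
  by split; apply: dual_sphere_normalize; rewrite ?bidual.
- by apply: compact_setX; exact: compact_dual_sphere.
- move=> [p k] [/= Sp Sk]; rewrite /g /= mulr_gt0//.
    by apply: sv; [exact: Sp.1|exact: dual_sphere_neq0 Sp].
  by apply: phi_pos; [move: Sk.1; rewrite bidual|exact: dual_sphere_neq0 Sk].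
have p_neq0 := dual_sphere_neq0 (conj Kp p1).
have k_neq0 := dual_sphere_neq0 (conj Kk k1).
rewrite /= bidual in Kk.
rewrite /f /g /= in tmin.
have pv : 0 < dot p v by exact: sv.
have phik : 0 < dot phi k by exact: phi_pos.
have gpk : 0 < dot p v * dot phi k by rewrite mulr_gt0.
have {}tmin q y : dual_cone K q -> K y ->
    dot p (X *m k) * (dot q v * dot phi y) <=
    dot q (X *m y) * (dot p v * dot phi k).
  move=> Kq Ky.
  have [->|q0] := eqVneq q 0; first by rewrite !dot0l !mul0r mulr0.
  have [->|y0] := eqVneq y 0; first by rewrite mulmx0 !dot0r !mulr0 mul0r.
  have Nq : 0 < `|q|^-1 by rewrite invr_gt0 normr_gt0.
  have Ny : 0 < `|y|^-1 by rewrite invr_gt0 normr_gt0.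
  have h : dual_sphere K (`|q|^-1 *: q) /\ dual_sphere (dual_cone K) (`|y|^-1 *: y).
    by split; apply: dual_sphere_normalize; rewrite ?bidual.
  have := tmin (`|q|^-1 *: q, `|y|^-1 *: y) h; rewrite /= -scalemxAr.
  rewrite !dotZl !dotZr => qy; rewrite -(ler_pM2l (mulr_gt0 Nq Ny)).
  by apply: etrans qy; congr (_ <= _); ring.
pose m := dot p (X *m k) / (dot p v * dot phi k).
have m0 : m < 0.
  rewrite pmulr_llt0 ?invr_gt0//.
  rewrite -(pmulr_llt0 _ (mulr_gt0 (sv _ Kp0 p00) (phi_pos _ Kk0 k00))).
  by rewrite (le_lt_trans (tmin _ _ Kp0 Kk0))// pmulr_llt0.
(* [Y] preserves [K] and touches the boundary at the pair [p], [k]. *)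
pose Y := X - m *: (v *m phi^T).
have YE y : Y *m y = X *m y - (m * dot phi y) *: v.
  by rewrite mulmxBl -scalemxAl outer_mulmx scalerA.
have dotY q y : dot q (Y *m y) = dot q (X *m y) - m * (dot q v * dot phi y).
  by rewrite YE dotBr dotZr -mulrA (mulrC (dot phi y)).
have KY y : K y -> K (Y *m y).
  move=> Ky; apply: (bipolar regK) => q Kq; rewrite dotY subr_ge0.
  by rewrite mulrAC ler_pdivrMr// tmin.
have pYk : dot p (Y *m k) = 0.
  by rewrite dotY divfK ?subrr// gt_eqF.
have KYp : dual_cone K (Y^T *m p).
  by move=> y Ky; rewrite -/(dot _ _) -dot_mulmx; exact: dual_ge0 Kp (KY _ Ky).
have hD := cD _ _ Kp (KY _ Kk) pYk.
have hA : 0 <= dot p (Y *m (A *m k)).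
  by rewrite dot_mulmx; apply: cA => //; rewrite -dot_mulmx.
have hT := dual_ge0 Kp (KT _ Kk).
rewrite mulNmx mulmxDl dotNr dotDr -!mulmxA in hT.
rewrite YE mulmxBr -scalemxAr dotBr dotZr in hD.
rewrite dotY in hA.
have := sDv _ Kp p_neq0; rewrite dotNr oppr_gt0 => pDv.
have phiAk := phiA _ Kk.
have : 0 < m * dot phi k * dot p (D *m v).
  by rewrite nmulr_lgt0// pmulr_llt0.
have : 0 <= m * (dot p v * dot phi (A *m k)).
  by rewrite nmulr_rge0// pmulr_rle0.
lra.
Qed.

End Functionals.

(** * A fixed point of the Riccati iteration *)

Section Riccati.
Context {R : realType} {n : nat}.
Context {K : set 'cV[R]_n} (regK : regular_cone K).
Implicit Types (p q x y v k phi : 'cV[R]_n) (A B C D M X : 'M[R]_n).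

Lemma nonneg_strict_eq0 X v : cone_nonneg K X -> strict K v ->
  X *m v = 0 -> X = 0.
Proof.
move=> /cone_nonnegP KX sv Xv.
have X0 y : X *m y = 0.
  have [c _ /KX] := order_unit regK y sv.
  rewrite mulmxDr -scalemxAr Xv scaler0 add0r => KXy.
  have [d _ /KX] := order_unit regK (- y) sv.
  rewrite mulmxDr -scalemxAr Xv scaler0 add0r mulmxN.
  exact: (antisym regK).
apply/matrixP => i j; have := X0 (delta_mx j 0); rewrite -colE.
by move=> /matrixP/(_ i 0); rewrite !mxE.
Qed.

(** Inverse positivity applied to a matrix in the kernel and to its opposite
    gives injectivity, hence surjectivity in finite dimension. *)
Lemma sylvester_surjective A D v phi Q :
  cross_positive K A -> cross_positive K D ->
  strict K v -> strict K (- (D *m v)) ->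
  (forall k, K k -> k != 0 -> 0 < dot phi k) ->
  (forall k, K k -> dot phi (A *m k) <= 0) ->
  exists X, D *m X + X *m A = Q.
Proof.
move=> cA cD sv sDv phi_pos phiA.
pose N := lin_mx (mulmx D) + lin_mx (mulmxr A) : 'M[R]_(n * n).
have NE u : vec_mx (u *m N) = D *m vec_mx u + vec_mx u *m A.
  by rewrite mulmxDr linearD /= !mx_rV_lin.
have uN : N \in unitmx.
  apply: unitmx_row_kernel => u uN.
  have Tu : D *m vec_mx u + vec_mx u *m A = 0 by rewrite -NE uN linear0.
  have K0 := cone0 regK.
  have nonneg (U : 'M[R]_n) : D *m U + U *m A = 0 -> cone_nonneg K U.
    move=> U0; apply: (sylvester_inverse_nonneg regK cA cD sv sDv phi_pos phiA).
    by apply/cone_nonnegP => k _; rewrite U0 oppr0 mul0mx.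
  have /cone_nonnegP KU := nonneg _ Tu.
  have /cone_nonnegP KNU : cone_nonneg K (- vec_mx u).
    by apply: nonneg; rewrite mulmxN mulNmx -opprD Tu oppr0.
  suff U0 : vec_mx u = 0 :> 'M[R]_n by rewrite -[u]vec_mxK U0 linear0.
  apply: (nonneg_strict_eq0 (nonneg _ Tu) sv).
  have Kv := strictW regK sv.
  apply: (antisym regK); first exact: KU.
  by rewrite -mulNmx; exact: KNU.
exists (vec_mx (mxvec Q *m invmx N)).
by rewrite -NE mulmxKV// mxvecK.
Qed.

(** The order interval is bounded: each basis vector is a difference of vectors
    of the cone dominated by multiples of [x0], and on the cone the norm is
    controlled by a functional [phi]. *)
Lemma nonneg_bounded x0 y0 : strict K x0 -> exists c, forall X,
  cone_nonneg K X -> K (y0 - X *m x0) -> forall i j, `|X i j| <= c.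
Proof.
move=> sx0; have [phi phi_pos] := positive_functional regK.
have [c c0 cK] := cone_norm_bound regK phi_pos.
have phi_ge0 k : K k -> 0 <= dot phi k.
  by have [->|k0 Kk] := eqVneq k 0; [rewrite dot0r|rewrite ltW// phi_pos].
pose e j : 'cV[R]_n := delta_mx j 0.
have [a aK] := choice (fun j => let: ex_intro2 a a0 Ka := order_unit regK (e j) sx0
  in ex_intro (fun a => 0 < a /\ K (a *: x0 + e j)) a (conj a0 Ka)).
have [b bK] := choice (fun j => let: ex_intro2 a a0 Ka := order_unit regK (- e j) sx0
  in ex_intro (fun a => 0 < a /\ K (a *: x0 - e j)) a (conj a0 Ka)).
pose g j := c * (a j + b j) * dot phi y0 + a j * (c * dot phi y0).
exists (\sum_j `|g j|) => X /cone_nonnegP KX KyX i j.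
have Kx0 : K (X *m x0) by apply: KX; exact: strictW.
have phiXx0 : dot phi (X *m x0) <= dot phi y0.
  by rewrite -subr_ge0 -dotBr phi_ge0.
have [aj0 /KX Ka] := aK j; have [bj0 /KX Kb] := bK j.
have -> : X i j = (X *m (a j *: x0 + e j) - a j *: (X *m x0)) i 0.
  by rewrite mulmxDr -scalemxAr addrC addKr -colE mxE.
apply: (@le_trans _ _ (g j)); last first.
  by rewrite (bigD1 j)//= (le_trans (ler_norm _))// lerDl sumr_ge0//.
apply: (le_trans (coord_le_norm _ _ _)); apply: (le_trans (ler_normB _ _)).
rewrite /g; apply: lerD.
  apply: (le_trans (cK _ Ka)); rewrite -mulrA; apply: ler_wpM2l => //.
  apply: (@le_trans _ _ ((a j + b j) * dot phi (X *m x0))); last first.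
    by apply: ler_wpM2l => //; rewrite addr_ge0// ltW.
  rewrite -subr_ge0 -dotZr -dotBr.
  have -> : (a j + b j) *: (X *m x0) - X *m (a j *: x0 + e j) = X *m (b j *: x0 - e j).
    by rewrite mulmxBr mulmxDr -!scalemxAr scalerDl opprD addrACA subrr add0r.
  exact: phi_ge0.
rewrite normrZ gtr0_norm//; apply: ler_wpM2l; first exact: ltW.
by apply: (le_trans (cK _ Kx0)); apply: ler_wpM2l.
Qed.

Lemma closed_cone_preimage (T : topologicalType) (h : T -> 'cV[R]_n) :
  continuous h -> closed [set t | K (h t)].
Proof.
move=> hc; apply: (@preimage_closed _ _ h K) => [t _|]; first exact: hc.
by rewrite -(bidual regK); exact: closed_dual_cone.
Qed.

Lemma closed_nonneg_preimage (T : topologicalType) (h : T -> 'M[R]_n) :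
  continuous h -> closed [set t | cone_nonneg K (h t)].
Proof.
move=> hc.
have -> : [set t | cone_nonneg K (h t)] = \bigcap_(k in K) [set t | K (h t *m k)].
  by apply/seteqP; split => t /= /cone_nonnegP.
apply: closed_bigI => k _; apply: closed_cone_preimage.
by apply: mulmx_continuous => //; exact: cst_continuous.
Qed.

Definition riccati A B C D X := X *m B *m X + D *m X + X *m A + C.

Lemma riccati_continuous A B C D : continuous (riccati A B C D).
Proof.
have idc : continuous (@id 'M[R]_n) by move=> X; exact: cvg_id.
have cst_cts M : continuous (fun _ : 'M[R]_n => M) by exact: cst_continuous.
apply: addmx_continuous => //; apply: addmx_continuous; last first.
  exact: (mulmx_continuous idc (cst_cts A)).
apply: addmx_continuous; last exact: (mulmx_continuous (cst_cts D) idc).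
exact: (mulmx_continuous (mulmx_continuous idc (cst_cts B)) idc).
Qed.

Lemma cone_nonnegD X M : cone_nonneg K X -> cone_nonneg K M -> cone_nonneg K (X + M).
Proof.
move=> /cone_nonnegP KX /cone_nonnegP KM; apply/cone_nonnegP => k Kk.
by rewrite mulmxDl; apply: coneD => //; [exact: KX|exact: KM].
Qed.

Lemma cone_nonnegM X M : cone_nonneg K X -> cone_nonneg K M -> cone_nonneg K (X *m M).
Proof.
move=> /cone_nonnegP KX /cone_nonnegP KM; apply/cone_nonnegP => k Kk.
by rewrite -mulmxA; apply: KX; exact: KM.
Qed.

(** Consider the compact set of subsolutions [X], namely the nonnegative [X]
    with [X *m x0] below [y0] and with nonnegative [riccati A B C D X].  One
    step of the iteration [D *m X' + X' *m A = - (X *m B *m X + C)] keeps [X] in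
    this set and does not decrease it.  So a subsolution maximising
    [dot phi (X *m x0)], for a strictly positive [phi], is a fixed point of the
    iteration, that is a solution. *)
Lemma riccati_solution A B C D x0 y0 :
  cross_positive K A -> cross_positive K D ->
  cone_nonneg K B -> cone_nonneg K C ->
  strict K x0 -> strict K y0 ->
  strict K (- (A *m x0 + B *m y0)) -> strict K (- (C *m x0 + D *m y0)) ->
  exists X, [/\ riccati A B C D X = 0, cone_nonneg K X & K (y0 - X *m x0)].
Proof.
move=> cA cD KB KC sx0 sy0 sf sg.
have K0 := cone0 regK.
have Kx0 := strictW regK sx0; have Ky0 := strictW regK sy0.
have act M : cone_nonneg K M -> forall k, K k -> K (M *m k) by move/cone_nonnegP.
have sAx0 : strict K (- (A *m x0)).
  have -> : - (A *m x0) = - (A *m x0 + B *m y0) + B *m y0 by rewrite opprD subrK.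
  by apply: strictD => //; exact: act.
have sDy0 : strict K (- (D *m y0)).
  have -> : - (D *m y0) = - (C *m x0 + D *m y0) + C *m x0.
    by rewrite opprD addrAC addNr add0r.
  by apply: strictD => //; exact: act.
have [phi [phi_pos phiA]] := decreasing_functional regK cA sx0 sAx0.
pose S := [set X | cone_nonneg K X] `&` ([set X | K (y0 - X *m x0)] `&`
  [set X | cone_nonneg K (riccati A B C D X)]).
have idc : continuous (@id 'M[R]_n) by move=> X; exact: cvg_id.
have evc v : continuous (fun X : 'M[R]_n => X *m v).
  by apply: mulmx_continuous => //; exact: cst_continuous.
have cS : compact S.
  have [c cb] := nonneg_bounded y0 sx0.
  apply: (@bounded_closed_compact_mx R n n _ c) => [X [KX [KyX _]]|].
    exact: cb.
  apply: closedI; first exact: closed_nonneg_preimage.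
  apply: closedI; last by apply: closed_nonneg_preimage; exact: riccati_continuous.
  apply: closed_cone_preimage; apply: addmx_continuous; first exact: cst_continuous.
  under eq_fun do rewrite -mulmxN; exact: evc.
have S0 : S !=set0.
  exists 0; split; [|split] => /=.
  - by apply/cone_nonnegP => k _; rewrite mul0mx.
  - by rewrite mul0mx subr0.
  - by rewrite /riccati !(mul0mx, mulmx0, add0r).
have psic : continuous (fun X : 'M[R]_n => dot phi (X *m x0)).
  by apply: dot_continuous; [exact: cst_continuous|exact: evc].
have [X /set_mem[KX [KyX KF]] Xmax] :=
  compact_EVT_max S0 cS (continuous_subspaceT psic).
have [X' X'E] := sylvester_surjective (- (X *m B *m X + C)) cA cD sy0 sDy0 phi_pos phiA.
have KdX : cone_nonneg K (X' - X).
  apply: (sylvester_inverse_nonneg regK cA cD sy0 sDy0 phi_pos phiA).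
  have -> : - (D *m (X' - X) + (X' - X) *m A) = riccati A B C D X.
    rewrite mulmxBr mulmxBl addrACA X'E -!opprD opprK /riccati -!addrA.
    by congr (_ + _); rewrite addrC -addrA.
  by [].
have X'X : X' = X + (X' - X) by rewrite addrC subrK.
have KX' : cone_nonneg K X' by rewrite X'X; exact: cone_nonnegD.
(* The right-hand side is [X' *m B *m X' - X *m B *m X], telescoped. *)
have FX' : riccati A B C D X' = (X' - X) *m B *m X' + X *m B *m (X' - X).
  rewrite /riccati -[_ + D *m X' + _]addrA X'E opprD addrA subrK.
  by rewrite !mulmxBl mulmxBr addrA subrK.
have X'S : S X'.
  split => //; split => /=; last first.
    by rewrite FX'; apply: cone_nonnegD; apply: cone_nonnegM => //; apply: cone_nonnegM.
  apply: (inverse_positive regK cD sy0 sDy0).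
  (* Every term below is in the cone, so [inverse_positive] for [D] yields
     [K (y0 - X' *m x0)]. *)
  have -> : - (D *m (y0 - X' *m x0)) = - (C *m x0 + D *m y0) +
      X' *m (- (A *m x0 + B *m y0)) + (X' - X) *m (B *m y0) +
      X *m (B *m (y0 - X *m x0)).
    have DX' : D *m X' = - (X *m B *m X + C) - X' *m A by rewrite -X'E addrK.
    rewrite mulmxBr [D *m (X' *m x0)]mulmxA DX'.
    rewrite !(mulmxBl, mulmxBr, mulmxDr, mulmxN, mulNmx, mulmxDl, mulmxA).
    move: (D *m y0) (X *m B *m X *m x0) (C *m x0) (X' *m A *m x0) => a b c d.
    move: (X' *m B *m y0) (X *m B *m y0) => e f.
    by apply/matrixP => i j; rewrite !mxE; ring.
  have KBv k : K k -> K (B *m k) by exact: act.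
  apply: coneD => //; last by apply: (act _ KX); exact: KBv.
  apply: coneD => //; last by apply: (act _ KdX); exact: KBv.
  apply: coneD => //; first exact: strictW.
  by apply: (act _ KX'); exact: strictW.
have dX : X' - X = 0.
  apply: (nonneg_strict_eq0 KdX sx0); apply/eqP; apply: contraT => nz.
  have := Xmax X' (mem_set X'S); rewrite leNgt => /negP[].
  by rewrite -subr_gt0 -dotBr -mulmxBl; apply: phi_pos => //; exact: act.
exists X; split => //.
have := FX'; rewrite dX mul0mx mulmx0 addr0 mul0mx.
by move/eqP: dX; rewrite subr_eq0 => /eqP ->.
Qed.

End Riccati.

(** * The block matrix and its Riccati equation *)

Section BlockMatrices.
Context {R : realType} {n : nat}.
Context {K : set 'cV[R]_n} (regK : regular_cone K).
Implicit Types (p q x y v k : 'cV[R]_n) (A B C D M X : 'M[R]_n).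

(** Test cross-positivity of the block matrix on pairs of vectors and
    functionals with one component equal to [0]. *)
Lemma cross_positive_block A B C D :
  cross_positive (cone_prod K K) (block_mx A B C D) ->
  [/\ cross_positive K A, cross_positive K D, cone_nonneg K B &
      cone_nonneg K C].
Proof.
move=> /cross_positiveE cL; have K0 := cone0 regK.
have K'0 : dual_cone K 0 by exact: dual_cone0.
have cL' p q x y : dual_cone K p -> dual_cone K q -> K x -> K y ->
    dot p x + dot q y = 0 ->
    0 <= dot p (A *m x + B *m y) + dot q (C *m x + D *m y).
  move=> Kp Kq Kx Ky; rewrite -!dot_col_mx -mul_block_col; apply: cL.
    by apply/dual_cone_prod.
  by apply/cone_prodE.
split.
- apply/cross_positiveE => p x Kp Kx px.
  have := cL' p 0 x 0 Kp K'0 Kx K0.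
  by rewrite !dot0l !mulmx0 !addr0; apply.
- apply/cross_positiveE => q y Kq Ky qy.
  have := cL' 0 q 0 y K'0 Kq K0 Ky.
  by rewrite !dot0l !mulmx0 !add0r; apply.
- apply/cone_nonnegP => y Ky; apply: (bipolar regK) => p Kp.
  have := cL' p 0 0 y Kp K'0 K0 Ky.
  by rewrite !dot0l !mulmx0 dot0r !addr0 add0r; apply.
- apply/cone_nonnegP => x Kx; apply: (bipolar regK) => q Kq.
  have := cL' 0 q x 0 K'0 Kq Kx K0.
  by rewrite !dot0l !mulmx0 dot0r !addr0 add0r; apply.
Qed.

Lemma cross_positiveD M X :
  cross_positive K M -> cone_nonneg K X -> cross_positive K (M + X).
Proof.
move=> /cross_positiveE cM /cone_nonnegP KX; apply/cross_positiveE => p x Kp Kx px.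
rewrite mulmxDl dotDr addr_ge0//; first exact: cM.
exact: dual_ge0 Kp (KX _ Kx).
Qed.

Lemma stable_inverse_nonneg M y : cross_positive K M -> stable M -> K y ->
  exists2 x, K x & M *m x = - y.
Proof.
move=> cM stM Ky.
have [v sv sMv] := strict_decrease_of_stable regK cM stM.
have uM := decrease_unitmx regK cM sv sMv.
exists (- (invmx M *m y)); last by rewrite mulmxN mulmxA mulmxV// mul1mx.
apply: (inverse_positive regK cM sv sMv).
by rewrite mulmxN mulmxA mulmxV// mul1mx opprK.
Qed.

(** The inverses of [- (D + X *m B)] and [- (A + B *m X)] are nonnegative.  With
    [d] and [x] chosen among their values, the vector with components [x]
    and [X *m x + d] is mapped by the block matrix to the vector with both
    components [- e], for a strict [e]; then [stable_of_decrease] applies. *)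
Lemma block_stable_of_riccati A B C D X :
  cross_positive (cone_prod K K) (block_mx A B C D) ->
  riccati A B C D X = 0 -> cone_nonneg K X ->
  stable (A + B *m X) -> cross_positive K (A + B *m X) ->
  stable (D + X *m B) -> cross_positive K (D + X *m B) ->
  stable (block_mx A B C D).
Proof.
move=> cL FX KX stA cA stD cD.
have [_ _ /cone_nonnegP KB _] := cross_positive_block cL.
move/cone_nonnegP in KX.
have [e se] := strict_nonempty regK; have Ke := strictW regK se.
have [d Kd dE] : exists2 d, K d & (D + X *m B) *m d = - (X *m e + e).
  by apply: stable_inverse_nonneg => //; apply: coneD => //; exact: KX.
have [x Kx xE] : exists2 x, K x & (A + B *m X) *m x = - (e + B *m d).
  by apply: stable_inverse_nonneg => //; apply: coneD => //; exact: KB.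
pose y := X *m x + d.
have Ky : K y by apply: coneD => //; exact: KX.
have upper : A *m x + B *m y = - e.
  by rewrite mulmxDr addrA mulmxA -mulmxDl xE opprD -addrA addNr addr0.
(* The Riccati equation expresses the lower component through the upper one. *)
have lower : C *m x + D *m y = - e.
  have -> : C *m x + D *m y = riccati A B C D X *m x -
      X *m (A *m x + B *m y) + (D + X *m B) *m d.
    rewrite /y /riccati !(mulmxDl, mulmxDr, mulmxA).
    move: (C *m x) (D *m X *m x) (D *m d) (X *m B *m X *m x) => a1 a2 a3 a4.
    move: (X *m A *m x) (X *m B *m d) => a5 a6.
    by apply/matrixP => i j; rewrite !mxE; ring.
  by rewrite FX mul0mx upper dE mulmxN opprK add0r opprD addrA subrr add0r.
apply: (stable_of_decrease (cone_prod_regular regK) cL (v := col_mx x y)).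
  by apply/cone_prodE.
rewrite mul_block_col upper lower opp_col_mx opprK.
by apply/strict_cone_prod.
Qed.

(** Stability of the block matrix gives a strict pair [x0], [y0] that it
    maps to the opposite of a strict pair.  The solution with [X *m x0] below
    [y0] is then stabilising: [A + B *m X] decreases [x0], and [D + X *m B]
    decreases [y0 - X *m x0]. *)
Lemma riccati_of_block_stable A B C D :
  cross_positive (cone_prod K K) (block_mx A B C D) ->
  stable (block_mx A B C D) ->
  exists X, [/\ riccati A B C D X = 0, cone_nonneg K X,
    stable (A + B *m X) /\ cross_positive K (A + B *m X) &
    stable (D + X *m B) /\ cross_positive K (D + X *m B)].
Proof.
move=> cL stL; have [cA cD KB KC] := cross_positive_block cL.
have [z] := strict_decrease_of_stable (cone_prod_regular regK) cL stL.
rewrite -[z]vsubmxK; set x0 := usubmx z; set y0 := dsubmx z.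
move=> /(strict_cone_prod _ _ regK)[sx0 sy0].
rewrite mul_block_col opp_col_mx => /(strict_cone_prod _ _ regK)[sf sg].
have [X [FX KX Kd]] := riccati_solution regK cA cD KB KC sx0 sy0 sf sg.
have cAX : cross_positive K (A + B *m X).
  by apply: cross_positiveD => //; exact: cone_nonnegM.
have cDX : cross_positive K (D + X *m B).
  by apply: cross_positiveD => //; exact: cone_nonnegM.
exists X; split => //; split => //.
  apply: (stable_of_decrease regK cAX (strictW regK sx0)).
  have -> : - ((A + B *m X) *m x0) =
      - (A *m x0 + B *m y0) + B *m (y0 - X *m x0).
    rewrite mulmxDl mulmxBr mulmxA; move: (B *m y0) => b.
    by rewrite !opprD addrA addrNK.
  by apply: strictD => //; move/cone_nonnegP: KB; apply.
apply: (stable_of_decrease regK cDX Kd).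
have -> : - ((D + X *m B) *m (y0 - X *m x0)) = - (C *m x0 + D *m y0) +
    X *m (- (A *m x0 + B *m y0)) + riccati A B C D X *m x0.
  rewrite /riccati !(mulmxDl, mulmxDr, mulmxN, mulmxBr, mulmxA).
  move: (C *m x0) (D *m X *m x0) (D *m y0) (X *m B *m X *m x0) => a1 a2 a3 a4.
  move: (X *m A *m x0) (X *m B *m y0) => a5 a6.
  by apply/matrixP => i j; rewrite !mxE; ring.
rewrite FX mul0mx addr0; apply: strictD => //.
by move/cone_nonnegP: KX; apply; exact: strictW.
Qed.

End BlockMatrices.

Theorem theorem1 (R : realType) (n : nat) (K : set 'cV[R]_n)
    (A B C D : 'M[R]_n) :
  proper_cone K ->
  cross_positive (cone_prod K K) (block_mx A B C D) ->
  stable (block_mx A B C D) <->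
  exists X : 'M[R]_n,
    [/\ X *m B *m X + D *m X + X *m A + C = 0,
        cone_nonneg K X,
        stable (A + B *m X) /\ cross_positive K (A + B *m X)
      & stable (D + X *m B) /\ cross_positive K (D + X *m B)].
Proof.
move=> /proper_cone_regular regK cL; split; first exact: riccati_of_block_stable.
move=> [X [FX KX [stA cA] [stD cD]]].
exact: (block_stable_of_riccati regK cL FX KX stA cA stD cD).
Qed.
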